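(* Assume that all random variables $Z_i(j)$ are centered, i.e. $\mathbb{E}Z_i(j)=0$. Then for $p\geq2$, $l\in\mathbb{N}$ (with $l\geq1$) and $p\geq l$, \[ \mathbb{E}\left[Z-2M\frac{\log(2N)}{\sqrt n}\right]_+^l\leq\left(\frac{35l^2}{n}\right)^{\frac l2}M^l. \]
   Context: Let $n,N$ be positive integers and $\mathcal{Z}_1,\dots,\mathcal{Z}_n$ probability spaces; all random variables below live on the product space with the product measure. For $1\leq i\leq n$, $1\leq j\leq N$ let $Z_i(j):\mathcal{Z}_i\to\mathbb{R}$ be random variables (independent across $i$, not necessarily identically distributed), $\mathbb{P}_nZ(j):=\frac1n\sum_{i=1}^nZ_i(j)$, $Z:=\max_{1\leq j\leq N}|\mathbb{P}_nZ(j)|$. Let $\mathcal{E}_i:\mathcal{Z}_i\to\mathbb{R}$ satisfy $|Z_i(j)|\leq\mathcal{E}_i$ for all $i,j$, and assume there are $p\in[1,\infty)$ and $M>0$ with $\mathbb{E}\mathcal{E}_i^p\leq M^p$ for all $i$. Notation: $(x)_+^l:=(\max\{0,x\})^l$; $\log$ is the natural logarithm. *)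

(* Defs.v *)
From HB Require Import structures.
From mathcomp Require Import all_boot all_order all_algebra.
From mathcomp Require Import all_classical all_reals all_analysis.
Set Implicit Arguments. Unset Strict Implicit. Unset Printing Implicit Defensive.
Import Order.TTheory GRing.Theory Num.Theory.
Import numFieldNormedType.Exports.
Local Open Scope classical_set_scope.
Local Open Scope ring_scope.

Definition gen_sigma {d} {T : measurableType d} {R : realType}
    (F : set (T -> R)) : set (set T) :=
  <<s [set A | exists f, F f /\ exists B : set R, measurable B /\ A = f @^-1` B] >>.

(* Mutual independence of a finite family of sub-sigma-algebras G_0..G_{n-1}
   under P: for every choice A_i in G_i, P(cap A_i) = prod P(A_i)
   (taking A_i = setT covers every finite subfamily). *)
Definition mutually_independent {d} {T : measurableType d} {R : realType}
    (P : probability T R) (n : nat) (G : 'I_n -> set (set T)) : Prop :=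
  forall A : 'I_n -> set T, (forall i, G i (A i)) ->
    P (\bigcap_(i in [set: 'I_n]) A i) = (\prod_(i < n) P (A i))%E.

(* Main.v *)
(** Rescale by [b := 1 / (2 M sqrt n)], writing [z] for [b Z_i(j)] and [v] for
    [b Env_i], and attach to each [i] the factor [exp (+- z)] if [v <= 1] and
    [(1 + v / l)^l] otherwise.  Bounded terms are thus handled by exponential
    moments and large ones by moments of order [l] only.

    Since [(x + w)^l <= l^l exp(x) (1 + w / l)^l] for [x, w >= 0], the [l]-th
    power of the rescaled excess over [log (2 N)] is at most [l^l] times the
    average, over the [2 N] choices of [j] and of the sign, of the products over
    [i] of these factors.  Each factor is at most
    [1 +- z + v^2 + e v^q] with [q = max(l, 2)], and [z] is centered, so its
    expectation is at most [1 + (1 + e) / (4 n) <= 1 + 1 / n]; by independence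
    the products have expectation at most [e], and [2 e <= sqrt 35]. *)
Require Import Defs.
From HB Require Import structures.
From mathcomp Require Import all_boot all_order all_algebra.
From mathcomp Require Import all_classical all_reals all_analysis.
From mathcomp Require Import measurable_realfun ring lra.
Import Order.TTheory GRing.Theory Num.Theory.
Import numFieldNormedType.Exports.
Import HBNNSimple.
Local Open Scope classical_set_scope.
Local Open Scope ring_scope.

(** * Elementary inequalities for exponentials and powers *)

(** Inverting [expR (- 1/16) >= 15/16] and taking 16th powers gives [(16/15)^16], about 2.81. The
    value 2.9 is small enough for both later uses: [1 + e <= 4] and [2 e <= sqrt 35]. *)
Lemma expR1_le {R : realType} : expR 1 <= 29 / 10 :> R.
Proof.
have e16 : expR (16^-1) <= 16 / 15 :> R.
  have := expR_ge1Dx (- (16^-1) : R); rewrite expRN => h.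
  rewrite -[leLHS]invrK -[leRHS]invrK lef_pV2 ?posrE ?invr_gt0 ?expR_gt0//; lra.
have -> : (1 : R) = 16%:R * 16^-1 by rewrite mulfV.
rewrite expRM_natl (le_trans (lerXn2r 16 _ _ e16)) ?nnegrE ?expR_ge0//; lra.
Qed.

(** Weighted arithmetic-geometric mean inequality for [u^p] and [1] with weights [k/p] and
    [1 - k/p]. Being pointwise and affine in [u^p], it lets the [p]-th moment control every moment
    of order [k <= p]. *)
Lemma powR_weighted_le {R : realType} (u p : R) (k : nat) :
  0 <= u -> (0 < k)%N -> k%:R <= p ->
  u ^+ k <= k%:R / p * u `^ p + (1 - k%:R / p).
Proof.
move=> u0 k0 kp; have k0R : 0 < k%:R :> R by rewrite ltr0n.
have p0 : 0 < p by lra.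
set s := k%:R / p; have s0 : 0 < s by rewrite divr_gt0.
have s1 : s <= 1 by rewrite ler_pdivrMr// mul1r.
move: u0; rewrite le_eqVlt => /predU1P[<-|u0].
  by rewrite expr0n (gtn_eqF k0) powR0 ?gt_eqF// mulr0 add0r subr_ge0.
rewrite -powR_mulrn ?(ltW u0)// /powR gt_eqF//.
set x := p * ln u.
have -> : k%:R * ln u = s * x by rewrite /s /x mulrA divfK ?gt_eqF.
(* Tangent line of [expR] at [s * x], evaluated at [x] and at [0]. *)
have h1 : expR (s * x) * (1 + (1 - s) * x) <= expR x.
  rewrite [X in _ <= expR X](_ : x = s * x + (1 - s) * x); last by ring.
  by rewrite expRD ler_pM2l ?expR_gt0// expR_ge1Dx.
have h2 : expR (s * x) * (1 - s * x) <= 1.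
  rewrite -[leRHS](expRxMexpNx_1 (s * x)) ler_pM2l ?expR_gt0//.
  exact: expR_ge1Dx.
(* With weights [s] and [1 - s] the terms linear in [x] cancel on the left, leaving
   [expR (s * x)]. *)
have h1' := ler_wpM2l (ltW s0) h1.
have h2' : (1 - s) * (expR (s * x) * (1 - s * x)) <= (1 - s) * 1.
  by apply: ler_wpM2l => //; lra.
nra.
Qed.

(** The function [(1 + x + x^2) exp(-x)] has derivative [x (1 - x) exp(-x)]: it decreases up to [0],
    increases on [[0, 1]], and equals [1] at [0]. *)
Lemma expR_le_quadratic {R : realType} (z : R) : z <= 1 -> expR z <= 1 + z + z ^+ 2.
Proof.
move=> z1; pose g (x : R) := (1 + x + x ^+ 2) * expR (- x).
pose dg (x : R) := x * (1 - x) * expR (- x).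
have dgE (x : R) : is_derive x 1 g (dg x).
  rewrite /g; apply: is_derive_eq.
  rewrite /dg /GRing.scale /=; ring.
have cg (a b : R) : {within `[a, b], continuous g}.
  apply: continuous_subspaceT => x.
  by apply/differentiable_continuous/derivable1_diffP; exact: (@ex_derive _ _ _ _ _ _ _ (dgE x)).
have g0 : g 0 = 1 by rewrite /g oppr0 expR0; ring.
suff : 1 <= g z.
  by rewrite /g expRN ler_pdivlMr ?expR_gt0// mul1r.
have [z0|z0] := leP 0 z.
  have [c cz] := MVT_segment z0 (fun x _ => dgE x) (cg _ _).
  rewrite g0 /dg; move: cz; rewrite in_itv/= => /andP[c0 cz] h.
  rewrite -subr_ge0 h !mulr_ge0 ?expR_ge0//; lra.
have [c cz] := MVT_segment (ltW z0) (fun x _ => dgE x) (cg _ _).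
rewrite g0 /dg; move: cz; rewrite in_itv/= => /andP[c0 cz] h.
rewrite -subr_ge0 -opprB h sub0r mulrN opprK mulr_le0 ?(ltW z0)//.
rewrite mulr_le0_ge0 ?expR_ge0// mulr_le0_ge0//; lra.
Qed.

(** * The mixed factors and the pointwise bound on the excess of the maximum *)

(** The case distinction is on the envelope [v], not on [z], so the same indices count as bounded
    for every [j] and for both signs. *)
Definition mixed_factor {R : realType} (l : nat) (z v : R) : R :=
  if v <= 1 then expR z else (1 + v / l%:R) ^+ l.

Lemma mixed_factor_ge0 {R : realType} (l : nat) (z v : R) : 0 <= mixed_factor l z v.
Proof.
rewrite /mixed_factor; case: (leP v 1) => [_|v1]; first exact: expR_ge0.
by rewrite exprn_ge0// addr_ge0// divr_ge0//; lra.
Qed.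

(** The term linear in [z] is kept exactly, so that centering removes it. For [v <= 1] the quadratic
    bound applies; for [v > 1], [1 + v / l <= (1 + 1 / l) v <= exp(1 / l) v], whose [l]-th power is
    [e v^l <= e v^q], while [1 + z + v^2 >= 0]. *)
Lemma mixed_factor_le {R : realType} (l q : nat) (z v : R) :
  (0 < l)%N -> (l <= q)%N -> `|z| <= v ->
  mixed_factor l z v <= 1 + z + v ^+ 2 + expR 1 * v ^+ q.
Proof.
move=> l0 lq zv; have v0 : 0 <= v := le_trans (normr_ge0 z) zv.
have l0R : 0 < l%:R :> R by rewrite ltr0n.
move: (zv); rewrite ler_norml => /andP[vz zv'].
rewrite /mixed_factor; case: (leP v 1) => [v1|v1].
  have z1 : z <= 1 by lra.
  rewrite (le_trans (expR_le_quadratic _ z1))// -[leLHS]addr0 lerD ?mulr_ge0 ?expR_ge0 ?exprn_ge0//.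
  by rewrite lerD2l -real_normK ?num_real// lerXn2r ?nnegrE.
rewrite -[leLHS]add0r lerD//; first by nra.
have -> : expR 1 = expR l%:R^-1 ^+ l :> R.
  by rewrite -expRM_natl mulfV ?gt_eqF.
apply: (@le_trans _ _ (expR l%:R^-1 ^+ l * v ^+ l)); last first.
  by rewrite ler_wpM2l ?exprn_ge0 ?expR_ge0// ler_weXn2l// ltW.
rewrite -exprMn lerXn2r ?nnegrE ?addr_ge0 ?mulr_ge0 ?expR_ge0 ?invr_ge0 ?(ltW l0R)//.
have := expR_ge1Dx (l%:R^-1 : R).
have : 0 < l%:R^-1 :> R by rewrite invr_gt0.
nra.
Qed.

(** Expanding [l (1 + x / l) (1 + w / l)] gives [x + w] plus nonnegative terms, and
    [1 + x / l <= exp(x / l)]. This turns the sum of a bounded part and a large part into a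
    product. *)
Lemma exprD_le_expR {R : realType} (l : nat) (x w : R) : (0 < l)%N -> 0 <= x -> 0 <= w ->
  (x + w) ^+ l <= l%:R ^+ l * (expR x * (1 + w / l%:R) ^+ l).
Proof.
move=> l0 x0 w0; have l0R : 0 < l%:R :> R by rewrite ltr0n.
have -> : expR x = expR (x / l%:R) ^+ l.
  by rewrite -expRM_natl mulrC divfK ?gt_eqF.
rewrite -!exprMn lerXn2r ?nnegrE ?mulr_ge0 ?addr_ge0 ?expR_ge0 ?divr_ge0 ?(ltW l0R)//.
have := expR_ge1Dx (x / l%:R).
have h : x + w <= l%:R * ((1 + x / l%:R) * (1 + w / l%:R)).
  have -> : l%:R * ((1 + x / l%:R) * (1 + w / l%:R)) = l%:R + x + w + x * w / l%:R.
    by field; rewrite gt_eqF.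
  have : 0 <= x * w / l%:R by rewrite !mulr_ge0 ?invr_ge0 ?(ltW l0R).
  lra.
move=> h2; apply: (le_trans h); rewrite ler_pM2l// ler_wpM2r// addr_ge0// divr_ge0//.
Qed.

(** The bounded indices multiply exactly to the exponential of their sum; for the others, a product
    of terms [1 + a_i] with [a_i >= 0] is at least [1] plus the sum of the [a_i]. *)
Lemma prod_mixed_factor_ge {R : realType} (n l : nat) (z v : 'I_n -> R) :
  expR (\sum_(i | v i <= 1) z i) * (1 + (\sum_(i | ~~ (v i <= 1)) v i) / l%:R) ^+ l
    <= \prod_i mixed_factor l (z i) (v i).
Proof.
rewrite [leRHS](bigID (fun i => v i <= 1))/= expR_sum.
have -> : \prod_(i | v i <= 1) mixed_factor l (z i) (v i) = \prod_(i | v i <= 1) expR (z i).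
  by apply: eq_bigr => i vi; rewrite /mixed_factor vi.
rewrite ler_wpM2l ?prodr_ge0//.
have -> : \prod_(i | ~~ (v i <= 1)) mixed_factor l (z i) (v i) =
    (\prod_(i | ~~ (v i <= 1)) (1 + v i / l%:R)) ^+ l.
  by rewrite -prodrXl; apply: eq_bigr => i vi; rewrite /mixed_factor (negbTE vi).
have v0 i : ~~ (v i <= 1) -> 0 <= v i / l%:R.
  by move=> /negP vi; rewrite divr_ge0//; lra.
have [h1 h2] : (0 <= (\sum_(i | ~~ (v i <= 1)) v i) / l%:R) /\ 
   1 + (\sum_(i | ~~ (v i <= 1)) v i) / l%:R <= \prod_(i | ~~ (v i <= 1)) (1 + v i / l%:R).
  (* Nonnegativity of the partial sums is carried along, since [(1 + a) (1 + c) >= 1 + (a + c)]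
     needs [a * c >= 0]. *)
  rewrite mulr_suml; apply: (big_ind2 (fun a b : R => 0 <= a /\ 1 + a <= b)).
  - by rewrite addr0.
  - move=> a b c e [a0 ab] [c0 ce]; split; first exact: addr_ge0.
    by apply: (@le_trans _ _ ((1 + a) * (1 + c))); [nra|apply: ler_pM => //; lra].
  - by move=> i vi; rewrite v0.
by rewrite lerXn2r ?nnegrE//; lra.
Qed.

Lemma expR_addN_ge2 {R : realType} (y : R) : 2 <= expR y + expR (- y).
Proof. by have := expR_ge1Dx y; have := expR_ge1Dx (- y); lra. Qed.

(* The average on the right-hand side is at least [1] because [cosh >= 1], so
   the positive part of the excess over [ln (2 * N)] costs nothing. *)
Lemma expR_excess_le_average {R : realType} (N : nat) (y : 'I_N -> R) (k : 'I_N) :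
  expR (Num.max 0 (`|y k| - ln (2 * N%:R))) <=
  (2 * N%:R)^-1 * \sum_(j < N) (expR (y j) + expR (- y j)).
Proof.
have N0 : 0 < N%:R :> R by rewrite ltr0n (leq_trans _ (ltn_ord k)).
have NN0 : 0 < 2 * N%:R :> R by rewrite mulr_gt0.
rewrite [leRHS]mulrC ler_pdivlMr//; case: (leP 0 (`|y k| - _)) => _.
  rewrite expRB lnK ?posrE// divfK ?gt_eqF// (bigD1 k)//= -[leLHS]addr0 lerD//.
    by case: (ger0P (y k)) => _; rewrite ?lerDl ?lerDr expR_ge0.
  by rewrite sumr_ge0// => j _; rewrite addr_ge0 ?expR_ge0.
rewrite expR0 mul1r mulr_natr -[X in _ *+ X]card_ord -sumr_const.
by apply: ler_sum => j _; exact: expR_addN_ge2.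
Qed.

(** Each sum is at most [|y j| + w], where [w] collects the large envelopes and does not depend on
    [j]. The power then splits into [exp] of the excess of [|y j|], averaged over [j] and the sign,
    and a common factor in [w]. *)
Lemma max_excess_le {R : realType} (n N l : nat) (z : 'I_n -> 'I_N -> R)
    (v : 'I_n -> R) : (0 < l)%N -> (0 < N)%N -> (forall i j, `|z i j| <= v i) ->
  Num.max 0 (\big[Num.max/0]_(j < N) `|\sum_i z i j| - ln (2 * N%:R)) ^+ l <=
  l%:R ^+ l * ((2 * N%:R)^-1 * \sum_(j < N)
    (\prod_i mixed_factor l (z i j) (v i) + \prod_i mixed_factor l (- z i j) (v i))).
Proof.
move=> l0 N0 zv; set L := ln _; set C := (X in _ <= X).
have L0 : 0 <= L by rewrite ln_ge0// -natrM ler1n muln_gt0.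
have v0 i : 0 <= v i := le_trans (normr_ge0 _) (zv i (Ordinal N0)).
pose y j := \sum_(i | v i <= 1) z i j.
pose w := \sum_(i | ~~ (v i <= 1)) v i.
have w0 : 0 <= w by rewrite sumr_ge0.
have wl0 : 0 <= (1 + w / l%:R) ^+ l by rewrite exprn_ge0// addr_ge0// divr_ge0.
have hC : l%:R ^+ l * ((2 * N%:R)^-1 * (\sum_(j < N) (expR (y j) + expR (- y j))) *
     (1 + w / l%:R) ^+ l) <= C.
  rewrite /C ler_wpM2l ?exprn_ge0// -mulrA ler_wpM2l ?invr_ge0 ?mulr_ge0//.
  rewrite mulr_suml ler_sum// => j _.
  by rewrite mulrDl lerD ?prod_mixed_factor_ge// -sumrN prod_mixed_factor_ge.
(* The bound passes through [Num.max], so it is checked for each [j] and for the default value [0],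
   whose excess vanishes because [L >= 0]. *)
apply: (big_ind (fun t => Num.max 0 (t - L) ^+ l <= C)).
- rewrite sub0r max_l ?oppr_le0// expr0n (gtn_eqF l0) (le_trans _ hC)//.
  apply: mulr_ge0; rewrite ?exprn_ge0// !mulr_ge0 ?invr_ge0 ?mulr_ge0//.
  by rewrite sumr_ge0// => j _; rewrite addr_ge0 ?expR_ge0.
- by move=> s t; case: (leP s t).
move=> j _; apply: le_trans hC.
apply: (@le_trans _ _ ((Num.max 0 (`|y j| - L) + w) ^+ l)).
  have hs : `|\sum_i z i j| <= `|y j| + w.
    rewrite (bigID (fun i => v i <= 1))/= (le_trans (ler_normD _ _))// lerD2l.
    by rewrite (le_trans (ler_norm_sum _ _ _))// ler_sum.
  rewrite lerXn2r ?nnegrE ?addr_ge0 ?le_max ?lexx//.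
  rewrite ge_max addr_ge0 ?le_max ?lexx//= (le_trans (lerB hs (lexx L)))//.
  by rewrite addrAC lerD2r le_max lexx orbT.
have h0 : 0 <= Num.max 0 (`|y j| - L) by rewrite le_max lexx.
rewrite (le_trans (exprD_le_expR _ _ _ l0 h0 w0))//.
by rewrite ler_wpM2l ?exprn_ge0// ler_wpM2r// expR_excess_le_average.
Qed.

(** * Independence: the integral of a product is the product of the integrals *)

(** The passage from indicators to simple functions and then to monotone limits is made in [f]
    alone, with [H] fixed, so that a product can be treated one factor at a time. *)
Lemma integral_mul_of_preimage {d} {T : measurableType d} {R : realType}
    (P : {measure set T -> \bar R}) (f H : T -> R) :
  measurable_fun setT f -> measurable_fun setT H ->
  (forall x, 0 <= f x) -> (forall x, 0 <= H x) ->
  (\int[P]_x (H x)%:E)%E \is a fin_num ->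
  (forall B, measurable B ->
    \int[P]_x (\1_(f @^-1` B) x * H x)%:E = P (f @^-1` B) * \int[P]_x (H x)%:E)%E ->
  (\int[P]_x (f x * H x)%:E = (\int[P]_x (f x)%:E) * \int[P]_x (H x)%:E)%E.
Proof.
move=> mf mH f0 H0 Hfin hB.
have mfB B : measurable B -> measurable (f @^-1` B).
  by move=> mB; rewrite -[X in measurable X]setTI; exact: mf.
have hS (h : {nnsfun R >-> R}) :
    (\int[P]_x (h (f x) * H x)%:E = (\int[P]_x (h (f x))%:E) * \int[P]_x (H x)%:E)%E.
  pose s := finmap.enum_fset (fset_set (range h)).
  pose A (y : R) := f @^-1` (h @^-1` [set y]).
  have mA y : measurable (A y) by apply: mfB; exact: measurable_sfunP.
  have hE x : h (f x) = \sum_(y <- s) y * \1_(A y) x.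
    by rewrite fimfunE fsbig_finite//.
  (* Membership of [y] in the nonnegative range of [h] is not carried along the sum; a negative [y]
     is harmless because its level set [A y] is empty. *)
  have yA0 y x : 0 <= y * \1_(A y) x.
    rewrite indicE; case: (asboolP (A y x)) => [Ay|nAy].
      by rewrite mem_set// mulr1; move: Ay; rewrite /A/= => <-.
    by rewrite memNset// mulr0.
  have myA y : measurable_fun setT (fun x => y * \1_(A y) x).
    by apply: measurable_funM => //; exact: measurable_indic.
  (* Used with [K = H] and with [K = 1], the latter giving the integral of [h (f x)] itself. *)
  have key (K : T -> R) : measurable_fun setT K -> (forall x, 0 <= K x) ->
    (\int[P]_x (h (f x) * K x)%:E = \sum_(y <- s) y%:E * \int[P]_x (\1_(A y) x * K x)%:E)%E.
    move=> mK K0.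
    transitivity (\int[P]_x (\sum_(y <- s) (y * \1_(A y) x * K x)%:E))%E.
      by apply: eq_integral => x _; rewrite hE sumEFin mulr_suml.
    rewrite ge0_integral_sum//=; last 2 first.
    - move=> y; apply/measurable_EFinP; exact: measurable_funM.
    - by move=> y x _; rewrite lee_fin mulr_ge0.
    apply: eq_bigr => y _; have [y0|y0] := leP 0 y.
      rewrite -ge0_integralZl_EFin//=.
      + by apply: eq_integral => x _; rewrite -EFinM mulrA.
      + by move=> x _; rewrite lee_fin mulr_ge0// indicE.
      + by apply/measurable_EFinP; apply: measurable_funM => //; exact: measurable_indic.
    have A0 x : \1_(A y) x = 0 :> R.
      have := yA0 y x; rewrite indicE; case: (x \in A y) => //=; lra.
    rewrite !integral0_eq ?mule0// => x _; by rewrite A0 ?mulr0 mul0r.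
  have h1 := key (cst 1) (measurable_cst _) (fun=> ler01).
  have -> : (\int[P]_x (h (f x))%:E = \sum_(y <- s) y%:E * P (A y))%E.
    transitivity (\int[P]_x (h (f x) * 1)%:E)%E.
      by apply: eq_integral => x _; rewrite mulr1.
    rewrite h1; apply: eq_bigr => y _; rewrite -[X in P X]setIT -integral_indic//.
    by congr (_ * _)%E; apply: eq_integral => x _; rewrite mulr1.
  rewrite ge0_sume_distrl; last first.
    move=> y _; have [y0|y0] := leP 0 y; first by rewrite mule_ge0.
    suff -> : A y = set0 by rewrite measure0 mule0.
    apply/seteqP; split => // x Ax.
    by have := yA0 y x; rewrite indicE mem_set// mulr1 leNgt y0.
  by rewrite key//; apply: eq_bigr => y _; rewrite -muleA hB.
(* The simple functions live on the real line, approximating the positive part of the identity, and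
   are composed with [f]; their level sets thus become preimages under [f]. *)
have mp : measurable_fun [set: R] (fun r : R => (Num.max r 0)%:E).
  by apply/measurable_EFinP; exact: measurable_maxr.
pose h := nnsfun_approx measurableT mp.
have hcvg x : (h m (f x))%:E @[m --> \oo] --> (f x)%:E.
  rewrite [X in _ --> X](_ : _ = (Num.max (f x) 0)%:E); last by rewrite max_l.
  apply: (@cvg_nnsfun_approx _ _ _ _ measurableT _ mp) => //.
  by move=> r _; rewrite lee_fin le_max lexx orbT.
have hnd x : {homo (fun m => h m (f x)) : a b / (a <= b)%N >-> a <= b}.
  by move=> a b ab; apply/lefP; exact: nd_nnsfun_approx.
have mh m : measurable_fun setT (fun x => h m (f x)) by exact: measurableT_comp.
have cvgK (K : T -> R) : measurable_fun setT K -> (forall x, 0 <= K x) ->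
    (\int[P]_x (h m (f x) * K x)%:E)%E @[m --> \oo] --> (\int[P]_x (f x * K x)%:E)%E.
  move=> mK K0.
  rewrite [X in _ --> X](_ : _ = \int[P]_x (limn (fun m => (h m (f x) * K x)%:E)))%E; last first.
    apply: eq_integral => x _; apply/esym/cvg_lim => //.
    by under eq_fun do rewrite EFinM; rewrite EFinM; apply: cvgeZr.
  apply: cvg_monotone_convergence => //.
  - by move=> m; apply/measurable_EFinP; exact: measurable_funM.
  - by move=> m x _; rewrite lee_fin mulr_ge0.
  - by move=> x _ a b ab; rewrite lee_fin ler_wpM2r//; exact: hnd.
have c1 := cvgK H mH H0.
have c2 := cvgK (cst 1) (measurable_cst _) (fun=> ler01).
apply: (cvg_unique _ c1) => //.
rewrite (_ : (fun m => \int[P]_x (h m (f x) * H x)%:E) =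
    (fun m => (\int[P]_x (h m (f x))%:E) * \int[P]_x (H x)%:E))%E; last first.
  by apply/funext => m; exact: hS.
apply: cvgeZr => //.
have -> : (\int[P]_x (f x)%:E)%E = (\int[P]_x (f x * 1)%:E)%E.
  by apply: eq_integral => x _; rewrite mulr1.
apply: cvg_trans c2; apply: near_eq_cvg; apply: nearW => m /=.
by apply: eq_integral => x _; rewrite mulr1.
Qed.

Lemma prod_indic {T : Type} {R : realType} (n : nat) (A : 'I_n -> set T) (x : T) :
  \prod_i \1_(A i) x = \1_(\bigcap_(i in [set: 'I_n]) A i) x :> R.
Proof.
have [Ax|/existsNP[i nAi]] := pselect (forall i, A i x).
  by rewrite indicE mem_set// big1// => i _; rewrite indicE mem_set.
rewrite [RHS]indicE memNset; last by move=> /(_ i Logic.I).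
by rewrite (bigD1 i)//= indicE memNset// mul0r.
Qed.

(** Starting from indicators, where the claim is mutual independence itself, the factors are
    replaced one at a time by general nonnegative ones. *)
Lemma integral_prod_independent {d} {T : measurableType d} {R : realType}
    (P : probability T R) (n : nat) (G : 'I_n -> set (set T)) (g : 'I_n -> T -> R) :
  (forall i, G i `<=` measurable) -> (forall i, G i setT) ->
  mutually_independent P G ->
  (forall i B, measurable B -> G i (g i @^-1` B)) -> (forall i x, 0 <= g i x) ->
  (forall i, (\int[P]_x (g i x)%:E)%E \is a fin_num) ->
  (\int[P]_x (\prod_i g i x)%:E = \prod_i \int[P]_x (g i x)%:E)%E.
Proof.
move=> Gm GT ind.
(* Induction on [k]: factors of index below [k] are general, the remaining ones are indicators of
   sets of [G i]. *)
suff main k : forall g : 'I_n -> T -> R,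
    (forall i : 'I_n, (i < k)%N -> forall B, measurable B -> G i (g i @^-1` B)) ->
    (forall i : 'I_n, (k <= i)%N -> exists2 A, G i A & g i = \1_A) ->
    (forall i x, 0 <= g i x) ->
    (forall i, (\int[P]_x (g i x)%:E)%E \is a fin_num) ->
    (\int[P]_x (\prod_i g i x)%:E = \prod_i \int[P]_x (g i x)%:E)%E.
  move=> gG g0 gfin; apply: (main n) => // i; first by move=> _; exact: gG.
  by rewrite leqNgt ltn_ord.
elim: k => [|k IH] {}g gG gI g0 gfin.
  pose A i := s2val (cid2 (gI i (leq0n i))).
  have GA i : G i (A i) by exact: (s2valP (cid2 (gI i (leq0n i)))).
  have gE i : g i = \1_(A i) by exact: (s2valP' (cid2 (gI i (leq0n i)))).
  transitivity (P (\bigcap_(i in [set: 'I_n]) A i)).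
    rewrite -[X in P X]setIT -integral_indic//; last first.
      by apply: fin_bigcap_measurable => // i _; exact: Gm.
    apply: eq_integral => x _; rewrite -prod_indic.
    by congr EFin; apply: eq_bigr => i _; rewrite gE.
  rewrite ind//; apply: eq_bigr => i _.
  by rewrite gE integral_indic ?setIT//; exact: Gm.
have [nk|kn] := leqP n k.
  apply: IH => // i ki; first exact/gG/ltnW.
  by have := leq_trans (ltn_ord i) nk; rewrite ltnNge ki.
pose i0 := Ordinal kn.
have mg i : measurable_fun setT (g i).
  have [ik|ki] := ltnP i k.+1.
    by move=> _ B mB; rewrite setTI; exact/Gm/gG.
  by have [A GA ->] := gI i ki; apply: measurable_indic; exact: (Gm i).
pose H x := \prod_(i | i != i0) g i x.
have mH : measurable_fun setT H.
  rewrite (_ : H = fun x => \prod_(i <- [seq i <- index_enum 'I_n | i != i0]) g i x).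
    by apply: measurable_prod.
  by apply/funext => x; rewrite /H big_filter.
have H0 x : 0 <= H x by exact: prodr_ge0.
have key A : G i0 A ->
    (\int[P]_x (\1_A x * H x)%:E = P A * \prod_(i | i != i0) \int[P]_x (g i x)%:E)%E.
  move=> GA; have mA := Gm _ _ GA.
  have gi0 : (\int[P]_x (\1_A x)%:E = P A)%E by rewrite integral_indic// setIT.
  (* Putting an indicator back at index [k] brings the product within reach of the induction
     hypothesis; this is the preimage condition for separating off [g i0]. *)
  pose g' i := if i == i0 then \1_A else g i.
  have g'i0 : g' i0 = \1_A by rewrite /g' eqxx.
  have g'i i : i != i0 -> g' i = g i by rewrite /g' => /negbTE ->.
  have := IH g'; rewrite (bigD1 i0)//= g'i0 gi0.
  have -> : (\prod_(i | i != i0) \int[P]_x (g' i x)%:E =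
             \prod_(i | i != i0) \int[P]_x (g i x)%:E)%E.
    by apply: eq_bigr => i /g'i ->.
  move=> <-.
  - apply: eq_integral => x _; rewrite (bigD1 i0)//= g'i0; congr (_ * _)%:E.
    by apply: eq_bigr => i /g'i ->.
  - move=> i ik; rewrite g'i; first exact/gG/ltnW.
    by rewrite -val_eqE/= ltn_eqF.
  - move=> i ki; have [->|ii0] := eqVneq i i0; first by exists A.
    rewrite g'i//; apply: gI; rewrite ltn_neqAle ki andbT eq_sym.
    by rewrite -val_eqE in ii0.
  - by move=> i x; rewrite /g'; case: ifP => // _; rewrite indicE.
  - move=> i; have [->|ii0] := eqVneq i i0; last by rewrite g'i.
    by rewrite g'i0 gi0 fin_num_measure.
(* The choice [A = setT] evaluates the integral of the remaining product. *)
have HE : (\int[P]_x (H x)%:E = \prod_(i | i != i0) \int[P]_x (g i x)%:E)%E.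
  have := key _ (GT i0); rewrite probability_setT mul1e => <-.
  by apply: eq_integral => x _; rewrite indicT mul1r.
rewrite [RHS](bigD1 i0)//= -HE -integral_mul_of_preimage//.
- by apply: eq_integral => x _; rewrite (bigD1 i0).
- by rewrite HE; apply: prode_fin_num.
- by move=> B mB; rewrite HE key//; apply: gG => /=.
Qed.

(** * Measurability of the factors, also for the generated sigma-algebras *)

Lemma measurable_mixed_factor {d} {T : measurableType d} {R : realType} (l : nat)
    (z v : T -> R) : measurable_fun setT z -> measurable_fun setT v ->
  measurable_fun setT (fun x => mixed_factor l (z x) (v x)).
Proof.
move=> mz mv; apply: measurable_fun_ifT.
- by apply: measurable_fun_ler.
- by apply: measurableT_comp.
- apply: measurable_funX; apply: measurable_funD => //; exact: measurable_funM.
Qed.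

Lemma gen_sigma_setT {d} {T : measurableType d} {R : realType} (F : set (T -> R)) :
  gen_sigma F setT.
Proof. exact: (@measurableT _ (g_sigma_algebraType _)). Qed.

Lemma gen_sigma_measurable {d} {T : measurableType d} {R : realType} (F : set (T -> R)) :
  (forall f, F f -> measurable_fun setT f) -> gen_sigma F `<=` measurable.
Proof.
move=> mF; apply: smallest_sub; first exact: sigma_algebra_measurable.
by move=> _ [f [/mF mf [B [mB ->]]]]; rewrite -[X in measurable X]setTI; exact: mf.
Qed.

(** Measurability of the factor is applied on [T] equipped with the sigma-algebra generated by [F].
    Separate scalars [a] and [b] allow a change of sign in [z] only. *)
Lemma gen_sigma_mixed_factor {d} {T : measurableType d} {R : realType} (l : nat)
    (F : set (T -> R)) (z v : T -> R) (a b : R) (B : set R) :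
  F z -> F v -> measurable B ->
  gen_sigma F ((fun x => mixed_factor l (a * z x) (b * v x)) @^-1` B).
Proof.
move=> Fz Fv mB.
pose gens := [set A | exists f, F f /\ exists B : set R, measurable B /\ A = f @^-1` B].
have mF f : F f -> measurable_fun [set: g_sigma_algebraType gens] f.
  move=> Ff _ C mC; rewrite setTI; apply: sub_sigma_algebra.
  by exists f; split => //; exists C.
have := @measurable_mixed_factor _ (g_sigma_algebraType gens) R l
  (fun x => a * z x) (fun x => b * v x).
rewrite -[X in gen_sigma _ X]setTI; apply => //.
- by apply: measurable_funM => //; exact: mF.
- by apply: measurable_funM => //; exact: mF.
Qed.

(** * Expectation of one factor and of their product *)

(** Since [2 sqrt n >= 1] and [k >= 2], the scaling contributes at most [(2 sqrt n)^-2 = 1 / (4 n)];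
    the power of [u] is handled by [powR_weighted_le]. *)
Lemma scaled_expr_le {R : realType} (n k : nat) (u p : R) : (0 < n)%N -> (2 <= k)%N ->
  0 <= u -> k%:R <= p ->
  (u / (2 * Num.sqrt n%:R)) ^+ k <=
  (4 * n%:R)^-1 * (k%:R / p * u `^ p + (1 - k%:R / p)).
Proof.
move=> n0 k2 u0 kp.
have sn1 : 1 <= Num.sqrt n%:R :> R by rewrite -[leLHS]sqrtr1 ler_wsqrtr// ler1n.
have n0R : 0 < n%:R :> R by rewrite ltr0n.
rewrite exprMn mulrC ler_pM ?exprn_ge0 ?invr_ge0 ?mulr_ge0 ?sqrtr_ge0//; last first.
  by apply: powR_weighted_le => //; exact: ltn_trans k2.
rewrite exprVn lef_pV2 ?posrE ?exprn_gt0 ?mulr_gt0//; last by lra.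
rewrite (_ : 4 * n%:R = (2 * Num.sqrt n%:R) ^+ 2).
  by rewrite ler_weXn2l//; lra.
by rewrite exprMn sqr_sqrtr ?(ltW n0R)//; ring.
Qed.

Lemma integral_mixed_factor_le {d} {T : measurableType d} {R : realType}
    (P : probability T R) (z e : T -> R) (p M a : R) (n l : nat) :
  (0 < n)%N -> (0 < l)%N -> l%:R <= p -> 2 <= p -> 0 < M ->
  measurable_fun setT z -> measurable_fun setT e -> (forall x, `|z x| <= e x) ->
  (\int[P]_x (e x `^ p)%:E <= (M `^ p)%:E)%E -> (\int[P]_x (z x)%:E = 0)%E ->
  `|a| <= (2 * M * Num.sqrt n%:R)^-1 ->
  (\int[P]_x (mixed_factor l (a * z x) ((2 * M * Num.sqrt n%:R)^-1 * e x))%:E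
     <= (1 + n%:R^-1)%:E)%E.
Proof.
move=> n0 l0 lp p2 M0 mz me ze ep z0 ab.
set b := _^-1.
have sn0 : 0 < Num.sqrt n%:R :> R by rewrite sqrtr_gt0 ltr0n.
have b0 : 0 < b by rewrite invr_gt0 !mulr_gt0.
have e0 x : 0 <= e x := le_trans (normr_ge0 _) (ze x).
(* An exponent of at least [2] is needed to gain [1 / n], and one of at least [l] to dominate the
   large factor; both are at most [p]. *)
pose q := maxn l 2.
have qp : q%:R <= p by rewrite /q /maxn; case: ifP.
pose D x := (e x / M) `^ p.
have D0 x : 0 <= D x by exact: powR_ge0.
have mD : measurable_fun setT D.
  by apply: (measurableT_comp (measurable_powR _)); exact: measurable_funM.
have intD : (\int[P]_x (D x)%:E <= 1)%E.
  have -> : (\int[P]_x (D x)%:E = (M^-1 `^ p)%:E * \int[P]_x (e x `^ p)%:E)%E.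
    rewrite -ge0_integralZl_EFin ?powR_ge0//.
    - apply: eq_integral => x _; rewrite -EFinM /D mulrC powRM// invr_ge0.
      exact: ltW.
    - by move=> x _; rewrite lee_fin powR_ge0.
    - by apply/measurable_EFinP; exact: (measurableT_comp (measurable_powR _)).
  rewrite (le_trans (lee_wpmul2l _ ep)) ?lee_fin ?powR_ge0//.
  by rewrite -powRM ?invr_ge0 ?(ltW M0)// mulVf ?gt_eqF// powR1.
have iD : P.-integrable setT (EFin \o D).
  apply/integrableP; split; first exact/measurable_EFinP.
  rewrite (le_lt_trans _ (ltry 1))//; under eq_integral do rewrite /= ger0_norm//.
  exact: intD.
have iZ : P.-integrable setT (EFin \o z).
  (* Exponent [1] in [powR_weighted_le] bounds [e x / M] by an affine function of [D x], which makes
     [z] integrable. *)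
  apply: (@le_integrable _ _ _ _ _ _ _ (fun x => M%:E * ((1%:R / p)%:E * (D x)%:E + (1 - 1%:R / p)%:E))%E) => //.
  - exact/measurable_EFinP.
  - move=> x _; rewrite -[X in (_ <= `|X|)%E]/((M * (1%:R / p * D x + (1 - 1%:R / p)))%:E).
    rewrite !abse_EFin lee_fin (le_trans _ (ler_norm _))//.
    rewrite (le_trans (ze x))// mulrC -ler_pdivrMr//.
    by have := @powR_weighted_le _ (e x / M) p 1; rewrite expr1; apply => //;
       [rewrite divr_ge0// ltW|lra].
  - apply: integrableZl => //; apply: integrableD => //; first exact: integrableZl.
    exact: finite_measure_integrable_cst.
(* Adding the bounds for exponents [2] and [q], [A] collects the coefficient of [D] and [B] the
   constant. The weights cancel in [A + B = (1 + e) / (4 n)]. *)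
pose A := (4 * n%:R)^-1 * (2%:R / p + expR 1 * (q%:R / p)) : R.
pose B := (4 * n%:R)^-1 * ((1 - 2%:R / p) + expR 1 * (1 - q%:R / p)) : R.
have n0R : 0 < n%:R :> R by rewrite ltr0n.
have A0 : 0 <= A.
  by rewrite /A mulr_ge0 ?invr_ge0 ?mulr_ge0// addr_ge0 ?mulr_ge0 ?expR_ge0 ?invr_ge0//; lra.
have pw x : mixed_factor l (a * z x) (b * e x) <= (1 + B) + (a * z x + A * D x).
  have abz : `|a * z x| <= b * e x by rewrite normrM ler_pM.
  rewrite (le_trans (mixed_factor_le _ q _ _ l0 (leq_maxl _ _) abz))//.
  have -> : b * e x = e x / M / (2 * Num.sqrt n%:R).
    by rewrite /b; field; rewrite !gt_eqF.
  have u0 : 0 <= e x / M by rewrite divr_ge0// ltW.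
  have h2 := scaled_expr_le n 2 (e x / M) p n0 isT u0 p2.
  have hq := scaled_expr_le n q (e x / M) p n0 (leq_maxr _ _) u0 qp.
  have hq' := ler_wpM2l (expR_ge0 1) hq.
  rewrite -[(e x / M) `^ p]/(D x) in h2 hq'.
  rewrite /A /B; move: h2 hq'; set X := _ ^+ 2; set Y := expR 1 * _ ^+ q; lra.
have mfz : measurable_fun setT (fun x => mixed_factor l (a * z x) (b * e x)).
  by apply: measurable_mixed_factor; exact: measurable_funM.
have iaz : P.-integrable setT (fun x => a%:E * (z x)%:E)%E by exact: (integrableZl _ _ iZ).
have iAD : P.-integrable setT (fun x => A%:E * (D x)%:E)%E by exact: (integrableZl _ _ iD).
apply: (@le_trans _ _ (\int[P]_x ((1 + B)%:E + (a%:E * (z x)%:E + A%:E * (D x)%:E)))%E).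
  apply: ge0_le_integral => //.
  - by move=> x _; rewrite lee_fin mixed_factor_ge0.
  - exact/measurable_EFinP.
  - apply/measurable_EFinP; apply: measurable_funD => //.
    by apply: measurable_funD; exact: measurable_funM.
  - by move=> x _; rewrite -!EFinM -!EFinD lee_fin.
rewrite integralD//; [|exact: finite_measure_integrable_cst|exact: integrableD].
rewrite integralD// integralZl// integralZl// z0 mule0 add0e.
have -> : (\int[P]__ (1 + B)%:E = (1 + B)%:E)%E.
  by rewrite integral_cst//= -[RHS]mule1; congr (_ * _)%E; exact: probability_setT.
apply: (@le_trans _ _ ((1 + B)%:E + A%:E)%E).
  by rewrite leeD// -[leRHS]mule1 lee_wpmul2l.
rewrite -EFinD lee_fin -addrA lerD2l.
have -> : B + A = (4 * n%:R)^-1 * (1 + expR 1) by rewrite /A /B; ring.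
rewrite invfM mulrAC -[leRHS]mul1r ler_wpM2r ?invr_ge0 ?(ltW n0R)//.
by have := @expR1_le R; lra.
Qed.

Lemma integral_prod_mixed_factor_le {d} {T : measurableType d} {R : realType}
    (P : probability T R) (n l : nat) (F : 'I_n -> set (T -> R))
    (z e : 'I_n -> T -> R) (p M a : R) :
  (0 < n)%N -> (0 < l)%N -> l%:R <= p -> 2 <= p -> 0 < M ->
  (forall i f, F i f -> measurable_fun setT f) ->
  mutually_independent P (fun i => gen_sigma (F i)) ->
  (forall i, F i (z i)) -> (forall i, F i (e i)) ->
  (forall i x, `|z i x| <= e i x) ->
  (forall i, (\int[P]_x (e i x `^ p)%:E <= (M `^ p)%:E)%E) ->
  (forall i, (\int[P]_x (z i x)%:E = 0)%E) ->
  `|a| <= (2 * M * Num.sqrt n%:R)^-1 ->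
  (\int[P]_x (\prod_i mixed_factor l (a * z i x)
      ((2 * M * Num.sqrt n%:R)^-1 * e i x))%:E <= (expR 1)%:E)%E.
Proof.
move=> n0 l0 lp p2 M0 mF ind Fz Fe ze ep z0 ab; set b := _^-1.
have le1 i : (\int[P]_x (mixed_factor l (a * z i x) (b * e i x))%:E <= (1 + n%:R^-1)%:E)%E.
  by apply: (integral_mixed_factor_le P _ _ p) => //; exact: (mF i).
have ge0 i : (0 <= \int[P]_x (mixed_factor l (a * z i x) (b * e i x))%:E)%E.
  by apply: integral_ge0 => x _; rewrite lee_fin mixed_factor_ge0.
have fin i : (\int[P]_x (mixed_factor l (a * z i x) (b * e i x))%:E)%E \is a fin_num.
  by rewrite ge0_fin_numE// (le_lt_trans (le1 i))// ltry.
rewrite (integral_prod_independent P n (fun i => gen_sigma (F i))) //; first last.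
- by move=> i x; exact: mixed_factor_ge0.
- by move=> i B mB; exact: gen_sigma_mixed_factor.
- by move=> i; exact: gen_sigma_setT.
- by move=> i; apply: gen_sigma_measurable => f; exact: mF.
under eq_bigr => i _ do rewrite -(fineK (fin i)).
rewrite prodEFin lee_fin.
apply: (@le_trans _ _ (\prod_(i < n) (1 + n%:R^-1))).
  apply: ler_prod => i _; rewrite fine_ge0//= -lee_fin fineK//.
rewrite prodr_const card_ord.
(* This gives [(1 + 1 / n)^n <= e] by comparing the bases. *)
have -> : expR 1 = expR n%:R^-1 ^+ n :> R.
  by rewrite -expRM_natl mulfV// pnatr_eq0 -lt0n.
by rewrite lerXn2r ?nnegrE ?expR_ge0 ?expR_ge1Dx// addr_ge0 ?invr_ge0.
Qed.

(** * The final constant and the conclusion *)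

Lemma measurable_bigmaxr {d} {T : measurableType d} {R : realType} (N : nat)
    (h : 'I_N -> T -> R) : (forall j, measurable_fun setT (h j)) ->
  measurable_fun setT (fun x => \big[Num.max/0]_(j < N) h j x).
Proof.
move=> mh; elim: (index_enum _) => [|j s IH].
  by under eq_fun do rewrite big_nil; exact: measurable_cst.
by under eq_fun do rewrite big_cons; exact: measurable_maxr.
Qed.

(** After writing the right-hand side as an [l]-th power, what remains is [e <= (sqrt 35 / 2)^l]. It
    holds for [l >= 1] because [e <= 2.9 <= sqrt 35 / 2], as [4 * 2.9^2 = 33.64]. *)
Lemma final_constant_le {R : realType} (n l : nat) (M : R) : (0 < n)%N -> (0 < l)%N -> 0 < M ->
  (2 * M / Num.sqrt n%:R) ^+ l * (l%:R ^+ l * expR 1) <=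
  (35 * l%:R ^+ 2 / n%:R) `^ (l%:R / 2) * M ^+ l.
Proof.
move=> n0 l0 M0; have n0R : 0 < n%:R :> R by rewrite ltr0n.
have l0R : 0 < l%:R :> R by rewrite ltr0n.
have sn0 : 0 < Num.sqrt n%:R :> R by rewrite sqrtr_gt0.
set s : R := Num.sqrt 35.
have s2 : s ^+ 2 = 35 by rewrite sqr_sqrtr.
have s0 : 0 <= s by exact: sqrtr_ge0.
have -> : 35 * l%:R ^+ 2 / n%:R = (s * l%:R / Num.sqrt n%:R) ^+ 2 :> R.
  by rewrite -s2 -[in LHS](@sqr_sqrtr _ n%:R) ?(ltW n0R)//; field; rewrite gt_eqF.
have h0 : 0 <= s * l%:R / Num.sqrt n%:R by rewrite !mulr_ge0 ?invr_ge0 ?(ltW sn0)// ltW.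
rewrite -(powR_mulrn 2 h0) -powRrM (_ : 2%:R * (l%:R / 2) = l%:R :> R); last by field.
rewrite powR_mulrn//.
have hs : expR 1 <= (s / 2) ^+ l.
  have s29 : 29 / 10 <= s / 2 by nra.
  rewrite (le_trans (@expR1_le R))// (le_trans s29)//.
  by rewrite -[leLHS]expr1 ler_weXn2l//; lra.
have -> : (s * l%:R / Num.sqrt n%:R) ^+ l * M ^+ l =
    (2 * M / Num.sqrt n%:R) ^+ l * (l%:R ^+ l * (s / 2) ^+ l).
  by rewrite -!exprMn; congr (_ ^+ _); field; rewrite gt_eqF.
by rewrite !ler_wpM2l ?exprn_ge0 ?divr_ge0 ?mulr_ge0 ?(ltW M0) ?(ltW sn0).
Qed.

Theorem theorem4p2 (R : realType) (d : measure_display) (T : measurableType d)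
    (P : probability T R) (n N : nat)
    (Zf : 'I_n -> 'I_N -> T -> R) (Env : 'I_n -> T -> R) (p M : R) (l : nat) :
  (0 < n)%N -> (0 < N)%N ->
  (forall i j, measurable_fun setT (Zf i j)) ->
  (forall i, measurable_fun setT (Env i)) ->
  mutually_independent P
    (fun i => gen_sigma [set f | f = Env i \/ exists j, f = Zf i j]) ->
  (forall i j x, `|Zf i j x| <= Env i x) ->
  1 <= p -> 0 < M ->
  (forall i, (\int[P]_x ((Env i x) `^ p)%:E <= (M `^ p)%:E)%E) ->
  (forall i j, (\int[P]_x (Zf i j x)%:E = 0)%E) ->
  2 <= p -> (1 <= l)%N -> l%:R <= p ->
  (\int[P]_x
     ((Num.max 0 (\big[Num.max/0]_(j < N) `|n%:R^-1 * \sum_(i < n) Zf i j x|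
                  - 2 * M * ln (2 * N%:R) / Num.sqrt n%:R)) ^+ l)%:E
   <= ((35 * l%:R ^+ 2 / n%:R) `^ (l%:R / 2) * M ^+ l)%:E)%E.
Proof.
move=> n0 N0 mZ mE ind ZE _ M0 Ep Z0 p2 l0 lp.
have n0R : 0 < n%:R :> R by rewrite ltr0n.
have N0R : 0 < N%:R :> R by rewrite ltr0n.
have sn0 : 0 < Num.sqrt n%:R :> R by rewrite sqrtr_gt0.
(* Here [b] rescales the variables and [k] undoes it up to the averaging, [k * b = 1 / n]; the
   threshold becomes [k * ln (2 * N)]. *)
pose b : R := (2 * M * Num.sqrt n%:R)^-1; pose k : R := 2 * M / Num.sqrt n%:R.
have b0 : 0 < b by rewrite invr_gt0 !mulr_gt0.
have k0 : 0 < k by rewrite divr_gt0 ?mulr_gt0.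
have kb : k * b = n%:R^-1.
  rewrite /k /b -[in RHS](@sqr_sqrtr _ n%:R) ?(ltW n0R)//.
  by field; rewrite !gt_eqF.
pose F (a : R) j x := \prod_i mixed_factor l (a * Zf i j x) (b * Env i x).
have F0 a j x : 0 <= F a j x by apply: prodr_ge0 => i _; exact: mixed_factor_ge0.
have mF a j : measurable_fun setT (F a j).
  apply: measurable_prod => i _; apply: measurable_mixed_factor; exact: measurable_funM.
have intF a j : `|a| <= b -> (\int[P]_x (F a j x)%:E <= (expR 1)%:E)%E.
  move=> ab.
  apply: (integral_prod_mixed_factor_le P n l
    (fun i => [set f | f = Env i \/ exists j, f = Zf i j]) (fun i => Zf i j) Env p) => //=.
  - by move=> i f [->//|[j' ->//]].
  - by move=> i; right; exists j.
  - by move=> i; left.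
pose K : R := k ^+ l * (l%:R ^+ l * (2 * N%:R)^-1).
have K0 : 0 <= K.
  apply: mulr_ge0; first exact/exprn_ge0/ltW.
  by rewrite mulr_ge0 ?exprn_ge0 ?invr_ge0 ?mulr_ge0.
have pw x : Num.max 0 (\big[Num.max/0]_(j < N) `|n%:R^-1 * \sum_(i < n) Zf i j x|
    - 2 * M * ln (2 * N%:R) / Num.sqrt n%:R) ^+ l <=
    K * \sum_(j < N) (F b j x + F (- b) j x).
  have -> : \big[Num.max/0]_(j < N) `|n%:R^-1 * \sum_(i < n) Zf i j x| =
      k * \big[Num.max/0]_(j < N) `|\sum_(i < n) b * Zf i j x|.
    (* Multiplication by [k > 0] commutes with the maximum and fixes its default value [0]. *)
    rewrite (@big_morph _ _ ( *%R k) 0 Num.max 0 Num.max) ?mulr0//; last first.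
      by move=> s t; rewrite maxr_pMr// ltW.
    apply: eq_bigr => j _; rewrite -mulr_sumr -kb -mulrA normrM gtr0_norm//.
  have -> : 2 * M * ln (2 * N%:R) / Num.sqrt n%:R = k * ln (2 * N%:R).
    by rewrite /k mulrAC.
  rewrite -mulrBr -[X in Num.max X _](mulr0 k) -maxr_pMr ?(ltW k0)// exprMn.
  rewrite /K -mulrA ler_wpM2l ?exprn_ge0 ?(ltW k0)//.
  have := @max_excess_le R n N l (fun i j => b * Zf i j x) (fun i => b * Env i x) l0 N0.
  have FN j : F (- b) j x = \prod_i mixed_factor l (- (b * Zf i j x)) (b * Env i x).
    by apply: eq_bigr => i _; rewrite mulNr.
  rewrite -mulrA; under [X in _ -> _ <= _ * (_ * X)]eq_bigr do rewrite FN.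
  apply => i j; by rewrite normrM gtr0_norm// ler_wpM2l ?(ltW b0).
apply: (@le_trans _ _ (\int[P]_x (K%:E * \sum_(j < N) ((F b j x)%:E + (F (- b) j x)%:E)))%E).
  apply: ge0_le_integral => //.
  - by move=> x _; rewrite lee_fin exprn_ge0// le_max lexx.
  - apply/measurable_EFinP; apply: measurable_funX; apply: measurable_maxr => //.
    apply: measurable_funB => //; apply: measurable_bigmaxr => j.
    apply: measurableT_comp => //; apply: measurable_funM => //.
    exact: measurable_sum.
  - apply/emeasurable_funM => //; apply: emeasurable_sum => j.
    by apply: emeasurable_funD; exact/measurable_EFinP.
  - move=> x _; under [X in (_ <= _ * X)%E]eq_bigr do rewrite -EFinD.
    by rewrite sumEFin -EFinM lee_fin.
have mFF j : measurable_fun setT (fun x => (F b j x)%:E + (F (- b) j x)%:E)%E.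
  by apply: emeasurable_funD; exact/measurable_EFinP.
rewrite ge0_integralZl_EFin//; last 2 first.
- by move=> x _; apply: sume_ge0 => j _; rewrite adde_ge0// lee_fin.
- exact: emeasurable_sum.
rewrite ge0_integral_sum//; last by move=> j x _; rewrite adde_ge0// lee_fin.
(* The two signs contribute [2 e] for each [j], so the total [2 N e] cancels the factor [(2 N)^-1]
   in [K]. *)
apply: (@le_trans _ _ (K%:E * \sum_(j < N) (2 * expR 1)%:E)%E).
  rewrite lee_wpmul2l ?lee_fin// lee_sum// => j _.
  rewrite ge0_integralD//; first last.
  - exact/measurable_EFinP.
  - by move=> x _; rewrite lee_fin.
  - exact/measurable_EFinP.
  - by move=> x _; rewrite lee_fin.
  rewrite mulrDl mul1r EFinD leeD// intF//; first by rewrite gtr0_norm.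
  by rewrite normrN gtr0_norm.
rewrite sumEFin -EFinM lee_fin sumr_const card_ord (le_trans _ (final_constant_le _ _ _ n0 l0 M0))//.
rewrite le_eqVlt; apply/predU1P; left.
by rewrite /K -/k -[_ *+ N]mulr_natr; field; rewrite gt_eqF.
Qed.
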